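(* Let $q$ be a prime power and let $n, t$ be positive integers. Let $S$ be a subset of the points of $\mathrm{PG}(n,q)$ such that any line in $\mathrm{PG}(n,q)$ intersects $S$ in at most $t$ points. Then the graph $\Gamma_{S,n,q}$ is $\{C_4, \theta_{3,t}\}$-free.
   Context: $\mathrm{PG}(n,q)$ denotes the projective space of (projective) dimension $n$ over the finite field $\mathbb{F}_q$. Given a set $S$ of points of $\mathrm{PG}(n,q)$, embed $\mathrm{PG}(n,q)$ as a hyperplane of $\mathrm{PG}(n+1,q)$. The linear representation of $S$ is the point-line geometry whose points are all the points of $\mathrm{PG}(n+1,q) \setminus \mathrm{PG}(n,q)$ and whose lines are all the lines of $\mathrm{PG}(n+1,q)$ which intersect $\mathrm{PG}(n,q)$ in precisely one point, namely a point of $S$. The graph $\Gamma_{S,n,q}$ is the point-line incidence graph of this geometry: it is the bipartite graph whose two parts are the points and the lines of the linear representation of $S$, with a point adjacent to a line if and only if the point lies on the line. A graph is $\mathcal{F}$-free if it contains no graph in $\mathcal{F}$ as a (not necessarily induced) subgraph. $C_4$ is the cycle of length 4. $\theta_{3,t}$ is the theta graph consisting of two vertices joined by $t$ internally vertex-disjoint paths, each with exactly 3 edges. *)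

(* Defs.v *)
From HB Require Import structures.
From mathcomp Require Import all_boot all_algebra.

Set Implicit Arguments.
Unset Strict Implicit.
Unset Printing Implicit Defensive.

Import GRing.Theory.
Local Open Scope ring_scope.

(* Over a finite field a vector space has finitely many subspaces; this makes
   {set _} and #|_| available for sets of points of a projective space. *)
HB.instance Definition _ (F : finFieldType) (vT : vectType F) :=
  isCountable.Build {vspace vT}
    (pcan_pickleK (can_pcan (@VectorInternalTheory.vs2mxK F vT))).
HB.instance Definition _ (F : finFieldType) (vT : vectType F) :=
  isFinite.Build {vspace vT}
    (pcan_enumP (can_pcan (@VectorInternalTheory.vs2mxK F vT))).

Record sgraph := SGraph {
  vertex :> finType;
  adj : rel vertex;
  adj_sym : symmetric adj;
  adj_irr : irreflexive adj }.

(* Not necessarily induced: adjacency is preserved but need not be reflected. *)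
Definition subgraph (H G : sgraph) : Prop :=
  exists2 f : H -> G, injective f & forall x y, adj x y -> adj (f x) (f y).

Definition graph_free (Fam : sgraph -> Prop) (G : sgraph) : Prop :=
  forall H, Fam H -> ~ subgraph H G.

Definition C4_adj (i j : 'I_4) : bool := (j == ordS i) || (i == ordS j).

Lemma C4_adj_sym : symmetric C4_adj.
Proof. by move=> i j; rewrite /C4_adj orbC. Qed.

Lemma C4_adj_irr : irreflexive C4_adj.
Proof. by case=> [[|[|[|[]]]]]. Qed.

Definition C4 : sgraph := SGraph C4_adj_sym C4_adj_irr.

(* inl false and inl true are the two joined vertices; the i-th path is
   inl false -- inr (i, false) -- inr (i, true) -- inl true. *)
Definition theta3_adj t (x y : bool + 'I_t * bool) : bool :=
  match x, y with
  | inl _, inl _ => false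
  | inl a, inr (_, b) | inr (_, b), inl a => a == b
  | inr (i, a), inr (j, b) => (i == j) && (a != b)
  end.

Lemma theta3_adj_sym t : symmetric (@theta3_adj t).
Proof.
by move=> [a|[i a]] [b|[j b]] //=; rewrite (eq_sym i) (eq_sym a).
Qed.

Lemma theta3_adj_irr t : irreflexive (@theta3_adj t).
Proof. by move=> [a|[i a]] //=; rewrite !eqxx. Qed.

Definition theta3 t : sgraph := SGraph (@theta3_adj_sym t) (@theta3_adj_irr t).

(* The points and lines of PG(n, q), q = #|F|, are the subspaces of F^(n+1) of
   vector dimension 1 and 2; incidence is inclusion of subspaces. *)
Definition pg_point (F : finFieldType) (n : nat) : finType :=
  {P : {vspace 'rV[F]_n.+1} | \dim P == 1%N}.

Definition pg_line (F : finFieldType) (n : nat) : finType :=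
  {L : {vspace 'rV[F]_n.+1} | \dim L == 2%N}.

Section LinearRepresentation.

(* When lker iota = 0, iota embeds PG(n, q) in PG(n+1, q) as the hyperplane
   limg iota, sending the point P to (iota @: P)%VS. *)
Variables (F : finFieldType) (n : nat).
Variable iota : 'Hom('rV[F]_n.+1, 'rV[F]_n.+2).
Variable S : {set pg_point F n}.

Definition lr_point : finType :=
  {P : pg_point F n.+1 | ~~ (val P <= limg iota)%VS}.

Definition lr_line : finType :=
  {L : pg_line F n.+1 |
    [exists P in S, (val L :&: limg iota == iota @: val P)%VS]}.

Definition lr_incident (P : lr_point) (L : lr_line) : bool :=
  (val (val P) <= val (val L))%VS.

Definition Gamma_adj (x y : lr_point + lr_line) : bool :=
  match x, y with
  | inl P, inr L | inr L, inl P => lr_incident P L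
  | _, _ => false
  end.

Lemma Gamma_adj_sym : symmetric Gamma_adj.
Proof. by move=> [P|L] [Q|M]. Qed.

Lemma Gamma_adj_irr : irreflexive Gamma_adj.
Proof. by move=> [P|L]. Qed.

Definition Gamma : sgraph := SGraph Gamma_adj_sym Gamma_adj_irr.

End LinearRepresentation.

(* Main.v *)
(* Two affine points lie on at most one common line, which excludes C_4. In a
   theta_{3,t} the two joined vertices are a point P and a line L; the t lines
   joining P to points of L, and L itself, have t + 1 distinct points at
   infinity, all of them on the trace at infinity of the plane <P, L>. *)

Require Import Defs.
From HB Require Import structures.
From mathcomp Require Import all_boot all_algebra.

Set Implicit Arguments.
Unset Strict Implicit.
Unset Printing Implicit Defensive.

Import GRing.Theory.
Local Open Scope ring_scope.

Lemma dim_addv_points (K : fieldType) (vT : vectType K) (A B : {vspace vT}) :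
  \dim A = 1%N -> \dim B = 1%N -> A <> B -> \dim (A + B) = 2%N.
Proof.
move=> dA dB neAB; have := dimv_sum_cap A B; rewrite dA dB.
have := dimvS (capvSl A B); rewrite dA.
case dAB: (\dim (A :&: B)) => [|[|m]] // _; first by rewrite addn0.
case: neAB; have /eqP <- : (A :&: B)%VS == A by rewrite eqEdim capvSl dA dAB.
by apply/eqP; rewrite eqEdim capvSr dB dAB.
Qed.

Lemma addv_points_eq (K : fieldType) (vT : vectType K) (A B L : {vspace vT}) :
  \dim A = 1%N -> \dim B = 1%N -> A <> B -> \dim L = 2%N ->
  (A <= L)%VS -> (B <= L)%VS -> (A + B)%VS = L.
Proof.
move=> dA dB neAB dL sAL sBL; apply/eqP.
by rewrite eqEdim subv_add sAL sBL dim_addv_points // dL.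
Qed.

Lemma limg_inj (K : fieldType) (aT rT : vectType K) (f : 'Hom(aT, rT)) :
  lker f = 0%VS -> injective (fun U : {vspace aT} => (f @: U)%VS).
Proof.
move=> /eqP kf0 U V eqUV; apply/eqP.
by rewrite eqEsubv -!(limg_ker0 _ _ kf0) eqUV subvv.
Qed.

Section LinearRepresentation.

Variables (F : finFieldType) (n : nat).
Variable iota : 'Hom('rV[F]_n.+1, 'rV[F]_n.+2).
Hypothesis iota_inj : lker iota = 0%VS.
Variable S : {set pg_point F n}.

Implicit Types (P Q : lr_point iota) (L M : lr_line iota S) (s : pg_point F n).

Lemma dim_limg_point s : \dim (iota @: val s) = 1%N.
Proof. by rewrite limg_dim_eq ?(eqP (valP s)) // iota_inj capv0. Qed.

Lemma dim_lr_point P : \dim (val (val P)) = 1%N.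
Proof. exact: eqP (valP (val P)). Qed.

Lemma dim_lr_line L : \dim (val (val L)) = 2%N.
Proof. exact: eqP (valP (val L)). Qed.

Lemma lr_join P Q L : P <> Q -> lr_incident P L -> lr_incident Q L ->
  (val (val P) + val (val Q))%VS = val (val L).
Proof.
move=> nePQ PL QL; apply: addv_points_eq => //; rewrite ?dim_lr_point ?dim_lr_line //.
by move=> /val_inj/val_inj.
Qed.

Lemma lr_line_uniq P Q L M : P <> Q -> lr_incident P L -> lr_incident Q L ->
  lr_incident P M -> lr_incident Q M -> L = M.
Proof. by move=> nePQ PL QL PM QM; do 2!apply: val_inj; rewrite -!(lr_join nePQ). Qed.

Lemma lr_line_at_infinity L : exists2 s, s \in S &
  (val (val L) :&: limg iota)%VS = (iota @: val s)%VS.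
Proof. by have /exists_inP[s sS /eqP sL] := valP L; exists s. Qed.

(** An affine point is never the point at infinity [iota @: val s], so both lines are the join of
    these two distinct points. *)
Lemma lr_line_uniq_at_infinity P L M s :
  (val (val L) :&: limg iota)%VS = (iota @: val s)%VS ->
  (val (val M) :&: limg iota)%VS = (iota @: val s)%VS ->
  lr_incident P L -> lr_incident P M -> L = M.
Proof.
move=> Ls Ms PL PM; do 2!apply: val_inj.
have nePs : val (val P) <> (iota @: val s)%VS.
  by move=> eqPs; have := valP P; rewrite eqPs limgS ?subvf.
have join (N : lr_line iota S) : (val (val N) :&: limg iota)%VS = (iota @: val s)%VS ->
    lr_incident P N -> (val (val P) + iota @: val s)%VS = val (val N).
  move=> Ns PN; apply: addv_points_eq => //;
    rewrite ?dim_lr_point ?dim_limg_point ?dim_lr_line //.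
  by rewrite -Ns capvSl.
by rewrite -(join L) // -(join M).
Qed.

(** [Gamma] is bipartite, so opposite vertices of the cycle are of the same kind: one opposite pair
    consists of points, and the other of two lines through both of them. *)
Lemma lr_C4_free : ~ subgraph C4 (Gamma iota S).
Proof.
case=> f f_inj f_adj.
pose v (i : nat) (lti : (i < 4)%N) := Ordinal lti.
have := (f_adj (@v 0 isT) (@v 1 isT) isT, f_adj (@v 1 isT) (@v 2 isT) isT,
         f_adj (@v 2 isT) (@v 3 isT) isT, f_adj (@v 3 isT) (@v 0 isT) isT).
have ne02 : f (@v 0 isT) <> f (@v 2 isT) by move/f_inj.
have ne13 : f (@v 1 isT) <> f (@v 3 isT) by move/f_inj.
(* Adjacency leaves only the two alternating patterns, with the points at the even or at the odd
   vertices. *)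
case: (f _) ne02 => a; case: (f (@v 2 _)) => c; case: (f _) ne13 => b;
  case: (f _) => d //= ne13 ne02 [[[ab bc] cd] da] //.
- by case: ne13; congr inr; apply: (@lr_line_uniq a c) => // eq_ac; case: ne02; rewrite eq_ac.
- by case: ne02; congr inr; apply: (@lr_line_uniq b d) => // eq_bd; case: ne13; rewrite eq_bd.
Qed.

Section Theta.

Variable t : nat.
Hypothesis t_gt0 : (0 < t)%N.
Hypothesis S_line : forall l : pg_line F n,
  (#|[set s in S | (val s <= val l)%VS]| <= t)%N.

Lemma lr_transversals P L (Ps : 'I_t -> lr_point iota) (Ls : 'I_t -> lr_line iota S) :
  injective Ls -> (forall i, Ls i <> L) -> (forall i, P <> Ps i) ->
  (forall i, lr_incident P (Ls i)) -> (forall i, lr_incident (Ps i) (Ls i)) ->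
  (forall i, lr_incident (Ps i) L) -> False.
Proof.
move=> Ls_inj neLs nePs PLs PsLs PsL.
(* The index type [option 'I_t] counts the [t.+1] lines, with [None] standing for [L]. *)
pose M o := oapp Ls L o.
have /fin_all_exists2[s sS Ms] o := lr_line_at_infinity (M o).
(* Any two of these lines share an affine point: [P] for two transversals, [Ps i] for [Ls i] and
   [L]. A common point at infinity would make them equal. *)
have s_inj : injective s.
  have meet o o' Q : s o = s o' ->
      lr_incident Q (M o) -> lr_incident Q (M o') -> M o = M o'.
    move=> eq_s; apply: (lr_line_uniq_at_infinity (Ms o)).
    by rewrite eq_s; exact: Ms.
  move=> [i|] [j|] // eq_s.
  - by congr Some; apply: Ls_inj; exact: (meet _ _ P eq_s (PLs i) (PLs j)).
  - by case: (neLs i); exact: (meet _ _ (Ps i) eq_s (PsLs i) (PsL i)).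
  - by case: (neLs j); exact/esym/(meet _ _ (Ps j) eq_s (PsL j) (PsLs j)).
pose U := (val (val P) + val (val L))%VS; pose W := (U :&: limg iota)%VS.
have MU o : (val (val (M o)) <= U)%VS.
  case: o => [i|] /=; last exact: addvSr.
  by rewrite -(lr_join (nePs i) (PLs i) (PsLs i)) addvS //; exact: PsL.
have sW o : (iota @: val (s o) <= W)%VS by rewrite -Ms capvS // MU.
have dW : \dim W = 2%N.
  apply/eqP; rewrite eqn_leq; apply/andP; split.
    (* Upper bound: [U] has dimension at most 3, and [W] is a proper subspace of it because [P] lies
       outside the hyperplane. *)
    have dU : (\dim U <= 3)%N.
      apply: leq_trans (dimv_add_leqif _ _) _.
      by rewrite dim_lr_point dim_lr_line.
    rewrite -ltnS; apply: leq_trans dU; rewrite ltnNge.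
    apply: contra (valP P) => dUW.
    have /eqP WU : W == U by rewrite eqEdim capvSl.
    by apply: subv_trans (capvSr U _); rewrite -/W WU addvSl.
  (* Lower bound: [W] contains two distinct points at infinity, that of [L] and that of one
     transversal, available since [0 < t]. *)
  have ne_s : s None <> s (Some (Ordinal t_gt0)) by move/s_inj.
  rewrite -(@dim_addv_points _ _ _ _ (dim_limg_point (s None))
            (dim_limg_point (s (Some (Ordinal t_gt0))))).
    by rewrite dimvS // subv_add !sW.
  by move=> /(limg_inj iota_inj)/val_inj.
(* [W] is pulled back along [iota] to a genuine line of PG(n, q), to which [S_line] applies. *)
have WK : (iota @: (iota @^-1: W))%VS = W by rewrite lpreimK // capvSr.
have dl : \dim (iota @^-1: W) == 2%N.
  by rewrite -dW -{2}WK limg_dim_eq // iota_inj capv0.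
have := S_line (Sub (iota @^-1: W)%VS dl); rewrite leqNgt => /negP; apply.
have -> : t.+1 = #|codom s| by rewrite card_codom // card_option card_ord.
apply/subset_leq_card/subsetP => _ /codomP[o ->].
by rewrite inE sS SubK -(limg_ker0 _ _ (introT eqP iota_inj)) WK; exact: sW.
Qed.

Lemma lr_theta3_free : ~ subgraph (theta3 t) (Gamma iota S).
Proof.
case=> f f_inj f_adj.
have adj0 b i : adj (f (inl b)) (f (inr (i, b))) by apply: f_adj; exact: eqxx.
have adj1 b i : adj (f (inr (i, b))) (f (inr (i, ~~ b))).
  by apply: f_adj; rewrite /= eqxx; case: (b).
have adj2 b i : adj (f (inr (i, ~~ b))) (f (inl (~~ b))) by apply: f_adj; exact: eqxx.
pose i0 := Ordinal t_gt0.
(* Keeping [b] arbitrary treats both orientations of the theta graph at once: a joined vertex that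
   is a point forces the other one to be a line, met by [t] transversals. *)
have no_point b P : f (inl b) <> inl P.
  move=> fP.
  have /fin_all_exists[Ls fLs] i : exists L, f (inr (i, b)) = inr L.
    by have := adj0 b i; rewrite fP; case: (f _) => // L; exists L.
  have /fin_all_exists[Ps fPs] i : exists Q, f (inr (i, ~~ b)) = inl Q.
    by have := adj1 b i; rewrite fLs; case: (f _) => // Q; exists Q.
  have [L fL] : exists L, f (inl (~~ b)) = inr L.
    by have := adj2 b i0; rewrite fPs; case: (f _) => // L; exists L.
  apply: (@lr_transversals P L Ps Ls) => [i j eqL|i eqL|i eqP|i|i|i].
  - by have /f_inj[] : f (inr (i, b)) = f (inr (j, b)) by rewrite !fLs eqL.
  - by have /f_inj : f (inr (i, b)) = f (inl (~~ b)) by rewrite fLs fL eqL.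
  - by have /f_inj : f (inl b) = f (inr (i, ~~ b)) by rewrite fP fPs eqP.
  - by have := adj0 b i; rewrite fP fLs.
  - by have := adj1 b i; rewrite fPs fLs.
  - by have := adj2 b i; rewrite fPs fL.
(* A path with 3 edges has its ends in different parts, so one of the joined vertices is a point
   after all. *)
have := (adj0 false i0, adj1 false i0, adj2 false i0).
case f0: (f (inl false)) => [P|L]; first by have := no_point _ _ f0.
case: (f (inr (i0, false))) => [P|?] [[//= _]].
case: (f (inr (i0, _))) => [//|M] _.
by case f1: (f (inl _)) => [Q|//]; have := no_point _ _ f1.
Qed.

End Theta.

End LinearRepresentation.

Theorem theorem2p2 (p k q : nat) (p_prime : prime p) (k_gt0 : (0 < k)%N)
    (q_def : q = (p ^ k)%N) (F : finFieldType) (cardF : #|F| = q)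
    (n t : nat) (n_gt0 : (0 < n)%N) (t_gt0 : (0 < t)%N)
    (iota : 'Hom('rV[F]_n.+1, 'rV[F]_n.+2)) (iota_inj : lker iota = 0%VS)
    (S : {set pg_point F n})
    (S_line : forall l : pg_line F n,
      (#|[set P in S | (val P <= val l)%VS]| <= t)%N) :
  graph_free (fun H => H = C4 \/ H = theta3 t) (Gamma iota S).
Proof.
move=> H [] ->; first exact: lr_C4_free.
exact: lr_theta3_free.
Qed.
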